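(* Let $\mathbf A=(A;w)$ be a finite algebra whose only basic operation $w$ is an $n$-ary weak near-unanimity operation, and let ${\sim}$ be an Abelian congruence of $\mathbf A$ with ${\sim}\prec 1_{\mathbf A}$ in $\mathrm{Con}\,\mathbf A$ and $\mathrm{typ}({\sim},1_{\mathbf A})=\mathbf 5$. Let $\le$ be the order on $A/{\sim}$ described below and $w_{|A|}$ the term operation defined below. If $O,I\in A/{\sim}$ and $O<I$, then $O\cup I$ is a subuniverse of $(A;w_{|A|})$, and for all $x_1,\dots,x_n\in\{O,I\}$ we have $w_{|A|}^{\mathbf A/{\sim}}(x_1,\dots,x_n)=x_1\wedge\dots\wedge x_n$, where $\wedge$ is the meet on $\{O,I\}$ with respect to $O<I$.
   Context: An $n$-ary operation $w$ is a weak near-unanimity (wnu) operation if it is idempotent and satisfies $w(x,\dots,x,y)=w(x,\dots,x,y,x)=\dots=w(y,x,\dots,x)$. Types are those of tame congruence theory. Order on $A/{\sim}$: for every $({\sim},1_{\mathbf A})$-minimal set $U$ (whose body is all of $U$), $U$ meets exactly two ${\sim}$-classes $C_1,C_2$, and the polynomial operations of $\mathbf A$ restricted to $U$ induce a two-element semilattice on $\{C_1\cap U, C_2\cap U\}$ modulo ${\sim}$; declare $C_1$ below $C_2$ if $C_1\cap U$ is the bottom of this semilattice. $\le$ is the reflexive-transitive closure of these relations over all minimal sets; it is a connected partial order on $A/{\sim}$, and $<$ is its strict part. Define operations $w_i$: $w_1=w$; $x\circ_i y:=w_i(y,x,\dots,x)$; $w_{i+1}(x_1,\dots,x_n)=w_i(w_i(x_1,\dots,x_n)\circ_i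 x_1,\dots,w_i(x_1,\dots,x_n)\circ_i x_n)$. *)

(* Defs.v *)
From mathcomp Require Import all_boot.
From Stdlib Require Export Relation_Operators.

Set Implicit Arguments.
Unset Strict Implicit.
Unset Printing Implicit Defensive.

(* An algebra with a single n-ary basic operation is given by its carrier and *)
(* that operation; relations on a finite carrier are boolean, and the         *)
(* elements of a quotient are the equivalence classes, as finite sets.        *)

Definition operation (A : Type) (n : nat) := n.-tuple A -> A.

Section Polynomials.
Variables (A : Type) (n : nat) (w : operation A n).

Inductive pterm (m : nat) : Type :=
| PVar of 'I_m
| PConst of A
| POp of 'I_n -> pterm m.

Fixpoint peval m (t : pterm m) (x : m.-tuple A) : A :=
  match t with
  | PVar i => tnth x i
  | PConst a => a
  | POp args => w [tuple peval (args i) x | i < n]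
  end.

Definition polynomial m (f : operation A m) : Prop :=
  exists t : pterm m, f =1 peval t.

End Polynomials.

Section WNU.
Variables (A : eqType) (n : nat).

Definition one_at (i : nat) (x y : A) : n.-tuple A :=
  [tuple if k == i :> nat then y else x | k < n].

Definition idempotent_op (w : operation A n) : Prop :=
  forall x, w [tuple x | _ < n] = x.

Definition weak_near_unanimity (w : operation A n) : Prop :=
  idempotent_op w /\
  forall (i j : 'I_n) (x y : A), w (one_at i x y) = w (one_at j x y).

Definition circ (f : operation A n) (x y : A) : A := f (one_at 0 x y).

Definition wnu_step (f : operation A n) : operation A n :=
  fun x => f [tuple circ f (f x) (tnth x k) | k < n].

(* The sequence is indexed from 1: wnu_seq w 1 = w. *)
Definition wnu_seq (w : operation A n) (i : nat) : operation A n :=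
  iter i.-1 wnu_step w.

End WNU.

Section Congruences.
Variables (A : finType) (n : nat) (w : operation A n).
Implicit Types (alpha beta theta e : rel A) (U N C S : {set A}).

Definition full_rel : rel A := fun _ _ => true.

Definition congruence e : Prop :=
  equivalence_rel e /\
  forall x y : n.-tuple A,
    (forall i, e (tnth x i) (tnth y i)) -> e (w x) (w y).

Definition covered_by alpha beta : Prop :=
  [/\ congruence alpha, congruence beta, subrel alpha beta,
      ~ subrel beta alpha &
      forall theta, congruence theta ->
        subrel alpha theta -> subrel theta beta ->
        theta =2 alpha \/ theta =2 beta].

(* The term condition C(alpha, beta; theta) defining the commutator. *)
Definition centralizes alpha beta theta : Prop :=
  forall m (f : operation A m.+1), polynomial w f ->
  forall (a b : A) (u v : m.-tuple A),
    alpha a b -> (forall i, beta (tnth u i) (tnth v i)) ->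
    theta (f [tuple of a :: u]) (f [tuple of a :: v]) <->
    theta (f [tuple of b :: u]) (f [tuple of b :: v]).

Definition abelian_congruence alpha : Prop :=
  congruence alpha /\ centralizes alpha alpha eq_op.

Definition classes e : {set {set A}} := equivalence_partition e [set: A].

Definition quotient_op m e (f : operation A m) (X : m.-tuple {set A}) :
    {set A} :=
  [set y | [exists x : m.-tuple A,
             [forall i, tnth x i \in tnth X i] && e (f x) y]].

Definition subuniverse m (f : operation A m) S : Prop :=
  forall x : m.-tuple A, (forall i, tnth x i \in S) -> f x \in S.

(* Images f(A) of the unary polynomials f with f(beta) not inside alpha. *)
Definition separating_image alpha beta U : Prop :=
  exists f : operation A 1,
    [/\ polynomial w f,
        exists x y, beta x y /\ ~~ alpha (f [tuple x]) (f [tuple y]) &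
        U = [set f [tuple x] | x in [set: A]]].

Definition minimal_set alpha beta U : Prop :=
  separating_image alpha beta U /\
  forall V : {set A}, separating_image alpha beta V -> V \subset U -> V = U.

Definition trace_of alpha beta U N : Prop :=
  exists x, [/\ x \in U, N = [set y in U | beta x y] &
                ~~ (N \subset [set y | alpha x y])].

Definition bool_meet : operation bool 2 :=
  fun x => tnth x ord0 && tnth x ord_max.

(* phi induces an isomorphism of the quotient by alpha of the algebra induced *)
(* by A on N (whose operations are the restrictions to N of the polynomials   *)
(* of A that preserve N) onto an algebra on bool polynomially equivalent to   *)
(* the semilattice (bool; &&), in which false is the bottom element.          *)
Definition semilattice_chart alpha N (phi : A -> bool) : Prop :=
  [/\ {in N &, forall x y, alpha x y = (phi x == phi y)},
      phi @: N = [set: bool] &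
      forall m (g : operation bool m),
        polynomial bool_meet g <->
        exists f : operation A m,
          [/\ polynomial w f, subuniverse f N &
              forall x : m.-tuple A, (forall i, tnth x i \in N) ->
                phi (f x) = g (map_tuple phi x)]].

(* When alpha is covered by beta, minimal sets and traces exist and all traces *)
(* have the same type, so quantifying over all of them is not vacuous.         *)
Definition has_type5 alpha beta : Prop :=
  forall U N, minimal_set alpha beta U -> trace_of alpha beta U N ->
  exists phi, semilattice_chart alpha N phi.

(* For beta = full_rel the only trace of a minimal set U is U itself. *)
Definition basic_below e (C1 C2 : {set A}) : Prop :=
  [/\ C1 \in classes e, C2 \in classes e &
      exists U phi,
        [/\ minimal_set e full_rel U, semilattice_chart e U phi,
            C1 :&: U = [set x in U | ~~ phi x] &
            C2 :&: U = [set x in U | phi x]]].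

Definition class_le e : {set A} -> {set A} -> Prop :=
  clos_refl_trans {set A} (basic_below e).

Definition class_lt e (C1 C2 : {set A}) : Prop :=
  class_le e C1 C2 /\ C1 <> C2.

(* The binary meet on the two-element chain O < I. *)
Definition chain_meet (O I X Y : {set A}) : {set A} :=
  if (X == O) || (Y == O) then O else I.

End Congruences.

Arguments full_rel {A}.

(* Main.v *)
(* A minimal set meets two classes modulo sim; some polynomial is a meet on
   them, none is a join, and a polynomial that separates them is inverted on
   them by another polynomial. Hence polynomials take such pairs of classes to
   such pairs, and are monotone for the order they generate. Retracting onto
   such a pair produces, whenever a < b, an up-closed set P containing b but
   not a through which no polynomial looks like a join: if c <= d, c' <= d' and
   P contains h(d, c') and h(c, d'), then it contains h(c, c'). For a wnu
   polynomial f and a <= b this gives f(b, a, ..., a) ~ a, and it gives a ~ b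
   when f(a, b, ..., b) ~ b. Therefore the values w_i(a, b, ..., b) strictly
   decrease until they reach the class of a, in at most |A| steps, and
   monotonicity yields the values of w_|A| at all tuples over the two classes.
*)

Require Import Defs.
From mathcomp Require Import all_boot.
From mathcomp Require Import boolp.
From Stdlib Require Import Operators_Properties.

Set Implicit Arguments.
Unset Strict Implicit.
Unset Printing Implicit Defensive.

Lemma iter_cancel_in (T : finType) (s : T -> T) (U : {set T}) :
  {homo s : x / x \in U} -> {in U &, injective s} ->
  exists k, {in U, cancel s (iter k s)}.
Proof.
move=> sU s_inj; exists (#|T|`!).-1 => x xU.
rewrite -iterSr prednK ?fact_gt0 //.
have /dvdnP[q ->] : order s x %| #|T|`!.
  by rewrite dvdn_fact // order_gt0 max_card.
elim: q => [|q IHq]; first by rewrite mul0n.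
by rewrite mulSn iterD IHq (iter_order_in sU).
Qed.

Lemma finite_seq_repeat (T : finType) (c : nat -> T) :
  exists i j, [/\ i < j, j <= #|T| & c i = c j].
Proof.
have /injectivePn[i [j neq_ij cij]] : ~~ injectiveb (fun i : 'I_#|T|.+1 => c i).
  apply/negP => /injectiveP/leq_card; by rewrite card_ord ltnn.
wlog lt_ij : i j neq_ij cij / i < j.
  move=> IH; case: (ltngtP i j) => [|lt_ji|/val_inj eq_ij]; first exact: IH.
  - by apply: (IH j i); rewrite // eq_sym.
  - by rewrite eq_ij eqxx in neq_ij.
by exists i, j; split; rewrite // -ltnS.
Qed.

Section EquivalenceRelations.
Variables (T : Type) (e : rel T).
Hypothesis e_equiv : equivalence_rel e.

Lemma equivalence_refl : reflexive e.
Proof. by case/equivalence_relP: e_equiv. Qed.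

Lemma equivalence_sym : symmetric e.
Proof.
have /equivalence_relP[e_refl e_ltrans] := e_equiv.
by apply: symmetric_from_pre => x y /e_ltrans <-.
Qed.

Lemma equivalence_trans : transitive e.
Proof.
by move=> y x z; have /equivalence_relP[_ e_ltrans] := e_equiv => /e_ltrans ->.
Qed.

Lemma equivalence_left_transitive : left_transitive e.
Proof. by case/equivalence_relP: e_equiv. Qed.

End EquivalenceRelations.

Section Polynomials.
Variables (A : Type) (n : nat) (w : operation A n).

Fixpoint psubst m k (t : pterm A n m) (s : 'I_m -> pterm A n k) :=
  match t with
  | PVar i => s i
  | PConst a => PConst n k a
  | POp args => POp (fun i => psubst (args i) s)
  end.

Lemma peval_subst m k (t : pterm A n m) (s : 'I_m -> pterm A n k) x :
  peval w (psubst t s) x = peval w t [tuple peval w (s i) x | i < m].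
Proof.
elim: t => [i|a|args IH] //=; first by rewrite tnth_mktuple.
by congr (w _); apply: eq_from_tnth => i; rewrite !tnth_mktuple IH.
Qed.

Lemma polynomial_ext m (f g : operation A m) :
  f =1 g -> polynomial w f -> polynomial w g.
Proof. by move=> fg [t ft]; exists t => x; rewrite -fg. Qed.

Lemma polynomial_var m (i : 'I_m) : polynomial w (fun x => tnth x i).
Proof. by exists (PVar A n i). Qed.

Lemma polynomial_const m a : polynomial w (fun _ : m.-tuple A => a).
Proof. by exists (PConst n m a). Qed.

Lemma polynomial_basic : polynomial w w.
Proof.
exists (POp (fun i => PVar A n i)) => x /=.
by congr (w _); apply: eq_from_tnth => i; rewrite tnth_mktuple.
Qed.

Lemma polynomial_comp m k (f : operation A m) (g : 'I_m -> operation A k) :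
  polynomial w f -> (forall i, polynomial w (g i)) ->
  polynomial w (fun x => f [tuple g i x | i < m]).
Proof.
case=> t ft /fin_all_exists [s gs]; exists (psubst t s) => x.
rewrite ft peval_subst; congr (peval w t _).
by apply: eq_from_tnth => i; rewrite !tnth_mktuple gs.
Qed.

Definition unary_polynomial (p : A -> A) : Prop :=
  polynomial w (fun x : 1.-tuple A => p (tnth x ord0)).

Definition binary_polynomial (h : A -> A -> A) : Prop :=
  polynomial w (fun x : 2.-tuple A => h (tnth x ord0) (tnth x ord_max)).

Lemma unary_polynomial_tuple (f : operation A 1) :
  polynomial w f -> unary_polynomial (fun x => f [tuple x]).
Proof.
move=> pf; apply: polynomial_ext pf => x; congr f.
by apply: eq_from_tnth => i; rewrite !ord1.
Qed.

Lemma binary_polynomial_tuple (f : operation A 2) :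
  polynomial w f -> binary_polynomial (fun x y => f [tuple x; y]).
Proof.
move=> pf; apply: polynomial_ext pf => x; congr f.
apply: eq_from_tnth => -[[|[|//]] lt_i] /=;
  by rewrite [RHS](tnth_nth (tnth x ord0)) /=; congr tnth; apply: val_inj.
Qed.

Lemma polynomial_comp1 p k (f : operation A k) :
  unary_polynomial p -> polynomial w f -> polynomial w (fun x => p (f x)).
Proof.
move=> pp pf.
apply: polynomial_ext (polynomial_comp (g := fun=> f) pp (fun=> pf)) => x.
by rewrite tnth_mktuple.
Qed.

Lemma polynomial_comp2 h k (f g : operation A k) :
  binary_polynomial h -> polynomial w f -> polynomial w g ->
  polynomial w (fun x => h (f x) (g x)).
Proof.
move=> ph pf pg.
have pfg (i : 'I_2) : polynomial w (if i == ord0 then f else g) by case: ifP.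
by apply: polynomial_ext (polynomial_comp ph pfg) => x; rewrite !tnth_mktuple.
Qed.

Lemma unary_polynomial_id : unary_polynomial id.
Proof. exact: polynomial_var. Qed.

Lemma unary_polynomial_iter p k :
  unary_polynomial p -> unary_polynomial (iter k p).
Proof.
move=> pp; elim: k => [|k IHk]; first exact: unary_polynomial_id.
exact: polynomial_comp1 pp IHk.
Qed.

Lemma binary_polynomial_fixr h b :
  binary_polynomial h -> unary_polynomial (h^~ b).
Proof.
move=> ph; apply: polynomial_comp2 => //; last exact: polynomial_const.
exact: polynomial_var.
Qed.

Lemma binary_polynomial_fixl h a :
  binary_polynomial h -> unary_polynomial (h a).
Proof.
move=> ph; apply: polynomial_comp2 => //; first exact: polynomial_const.
exact: polynomial_var.
Qed.

Lemma binary_polynomial_comp h q r :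
  binary_polynomial h -> unary_polynomial q -> unary_polynomial r ->
  binary_polynomial (fun x y => h (q x) (r y)).
Proof.
move=> ph pq pr.
exact: (polynomial_comp2 ph (polynomial_comp1 pq (polynomial_var ord0))
  (polynomial_comp1 pr (polynomial_var ord_max))).
Qed.

Lemma polynomial_cons m k (f : operation A m.+1) (g : operation A k)
    (t : k.-tuple A -> m.-tuple A) :
  polynomial w f -> polynomial w g ->
  (forall j, polynomial w (fun x => tnth (t x) j)) ->
  polynomial w (fun x => f [tuple of g x :: t x]).
Proof.
move=> pf pg pt; pose arg i (x : k.-tuple A) :=
  if unlift ord0 i is Some j then tnth (t x) j else g x.
apply: polynomial_ext (polynomial_comp (g := arg) pf _) => [x|i].
  congr f; apply: eq_from_tnth => i; rewrite tnth_mktuple /arg.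
  by case: unliftP => [j|] ->; rewrite ?tnthS ?tnth0.
by rewrite /arg; case: (unlift _ i).
Qed.

Lemma polynomial_compat_unary (R : A -> A -> Prop) m (f : operation A m) :
  (forall a, R a a) -> (forall a b c, R a b -> R b c -> R a c) ->
  (forall p, unary_polynomial p -> forall a b, R a b -> R (p a) (p b)) ->
  polynomial w f ->
  forall x y, (forall i, R (tnth x i) (tnth y i)) -> R (f x) (f y).
Proof.
move=> R_refl R_trans R_unary.
elim: m f => [|m IHm] f pf x y; first by rewrite (tuple0 x) (tuple0 y).
case/tupleP: x => a u; case/tupleP: y => b v Rxy.
apply: (R_trans _ (f [tuple of b :: u])).
  have Rab : R a b by have := Rxy ord0; rewrite !tnth0.
  apply: (R_unary (fun c => f [tuple of c :: u])) Rab.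
  apply: (polynomial_cons (t := fun=> u) pf (polynomial_var ord0)) => j.
  exact: polynomial_const.
apply: (IHm (fun z => f [tuple of b :: z])) => [|i].
  apply: (polynomial_cons (t := id) pf (polynomial_const m b)) => j.
  exact: polynomial_var.
by have := Rxy (lift ord0 i); rewrite !tnthS.
Qed.

End Polynomials.

Section WeakNearUnanimityOperations.
Variables (A : eqType) (n : nat).
Implicit Types f : operation A n.

Lemma circ_id f x : Defs.idempotent_op f -> circ f x x = x.
Proof.
move=> f_id; rewrite -[RHS]f_id; congr f.
by apply: eq_from_tnth => k; rewrite !tnth_mktuple if_same.
Qed.

Lemma circ_arity_le1 f x y : n <= 1 -> Defs.idempotent_op f -> circ f x y = y.
Proof.
move=> le_n1 f_id; rewrite -[RHS]f_id; congr f.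
apply: eq_from_tnth => k; rewrite !tnth_mktuple.
by rewrite -leqn0 -ltnS (leq_trans (ltn_ord k)).
Qed.

Lemma circ_wnu_step f x y :
  circ (wnu_step f) x y
    = circ f (circ f (circ f x y) x) (circ f (circ f x y) y).
Proof.
by congr f; apply: eq_from_tnth => k; rewrite !tnth_mktuple; case: ifP.
Qed.

Lemma wnu_step_wnu f :
  weak_near_unanimity f -> weak_near_unanimity (wnu_step f).
Proof.
case=> f_id f_sym; split=> [x|i j x y].
  rewrite /wnu_step f_id -[RHS]f_id; congr f.
  by apply: eq_from_tnth => k; rewrite !tnth_mktuple circ_id.
have step_one_at k : wnu_step f (one_at n k x y) =
    let z := f (one_at n k x y) in f (one_at n k (circ f z x) (circ f z y)).
  by congr f; apply: eq_from_tnth => l; rewrite !tnth_mktuple; case: ifP.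
by rewrite !step_one_at (f_sym i j) /= (f_sym i j).
Qed.

Lemma polynomial_wnu_step (w f : operation A n) :
  polynomial w f -> polynomial w (wnu_step f).
Proof.
move=> pf.
apply: (polynomial_comp (g := fun k x => circ f (f x) (tnth x k))) => // k.
pose g (i : 'I_n) (x : n.-tuple A) := if i == 0 :> nat then tnth x k else f x.
apply: (polynomial_comp (g := g) pf) => i; rewrite /g.
by case: (i == 0 :> nat) => //; apply: polynomial_var.
Qed.

Lemma wnu_seq_wnu f k :
  weak_near_unanimity f -> weak_near_unanimity (wnu_seq f k).
Proof.
by rewrite /wnu_seq => f_wnu; elim: k.-1 => //= j; apply: wnu_step_wnu.
Qed.

Lemma polynomial_wnu_seq (w : operation A n) k : polynomial w (wnu_seq w k).
Proof.
rewrite /wnu_seq; elim: k.-1 => [|j]; first exact: polynomial_basic.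
exact: polynomial_wnu_step.
Qed.

Definition block_tuple (S : {set 'I_n}) (x y : A) : n.-tuple A :=
  [tuple if k \in S then x else y | k < n].

Lemma block_tuple_set0 x y : block_tuple set0 x y = [tuple y | _ < n].
Proof. by apply: eq_from_tnth => k; rewrite !tnth_mktuple inE. Qed.

Lemma block_tuple_setT x y : block_tuple setT x y = [tuple x | _ < n].
Proof. by apply: eq_from_tnth => k; rewrite !tnth_mktuple inE. Qed.

Lemma one_at_block (i : 'I_n) x y : one_at n i x y = block_tuple [set i] y x.
Proof. by apply: eq_from_tnth => k; rewrite !tnth_mktuple inE. Qed.

Lemma one_at_blockC (i : 'I_n) x y : one_at n i x y = block_tuple [set~ i] x y.
Proof.
apply: eq_from_tnth => k; rewrite !tnth_mktuple !inE.
by rewrite -[_ == _ :> nat]/(k == i); case: eqP.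
Qed.

End WeakNearUnanimityOperations.

Section Congruences.
Variables (A : finType) (n : nat) (w : operation A n).
Implicit Types e alpha beta : rel A.

Lemma congruence_polynomial e m (f : operation A m) (x y : m.-tuple A) :
  congruence w e -> polynomial w f -> (forall i, e (tnth x i) (tnth y i)) ->
  e (f x) (f y).
Proof.
move=> [e_equiv e_w] [t ft] xy; rewrite !ft.
elim: t {f ft} => [i|a|args IH] //=; first exact: equivalence_refl.
by apply: e_w => i; rewrite !tnth_mktuple.
Qed.

Lemma congruence_unary e p a b :
  congruence w e -> unary_polynomial w p -> e a b -> e (p a) (p b).
Proof.
move=> e_cong pp ab.
apply: (congruence_polynomial (x := [tuple a]) (y := [tuple b]) e_cong pp) => i.
by rewrite !ord1.
Qed.

Lemma congruence_binary e h a b c d :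
  congruence w e -> binary_polynomial w h ->
  e a b -> e c d -> e (h a c) (h b d).
Proof.
move=> e_cong ph ab cd.
apply: (congruence_polynomial
  (x := [tuple a; c]) (y := [tuple b; d]) e_cong ph).
by case=> [[|[|//]] lt_i].
Qed.

Definition polynomial_kernel alpha beta (f : A -> A) : rel A := fun a b =>
  beta a b &&
  `[< forall g, unary_polynomial w g -> alpha (f (g a)) (f (g b)) >].

Lemma polynomial_kernel_congruence alpha beta f :
  congruence w alpha -> congruence w beta ->
  congruence w (polynomial_kernel alpha beta f).
Proof.
move=> alpha_cong beta_cong.
have [[alpha_eqv _] [beta_eqv _]] := (alpha_cong, beta_cong).
have ker_refl : reflexive (polynomial_kernel alpha beta f).
  move=> a; rewrite /polynomial_kernel equivalence_refl //=.
  by apply/asboolP => g _; apply: equivalence_refl.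
have ker_sym : symmetric (polynomial_kernel alpha beta f).
  apply: symmetric_from_pre => a b /andP[ab /asboolP fab].
  apply/andP; split; first by rewrite equivalence_sym.
  by apply/asboolP => g pg; rewrite equivalence_sym //; apply: fab.
have ker_trans : transitive (polynomial_kernel alpha beta f).
  move=> b a c /andP[ab /asboolP fab] /andP[bc /asboolP fbc]; apply/andP; split.
    exact: equivalence_trans ab bc.
  apply/asboolP => g pg.
  exact: (equivalence_trans alpha_eqv (fab g pg) (fbc g pg)).
split; first by apply/equivalence_relP; split=> //; apply: sym_left_transitive.
apply: (polynomial_compat_unary (R := polynomial_kernel alpha beta f)
  ker_refl _ _ (polynomial_basic w)) => [a b c|]; first exact: ker_trans.
move=> p pp a b /andP[ab /asboolP fab]; apply/andP; split.
  exact: congruence_unary beta_cong pp ab.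
by apply/asboolP => g pg; apply: (fab (g \o p)) (polynomial_comp1 pg pp).
Qed.

End Congruences.

Section MinimalSets.
Variables (A : finType) (n : nat) (w : operation A n) (alpha beta : rel A).
Hypothesis alpha_cover : covered_by w alpha beta.
Implicit Types (U V : {set A}) (p : A -> A).

Let alpha_cong : congruence w alpha. Proof. by case: alpha_cover. Qed.
Let beta_cong : congruence w beta. Proof. by case: alpha_cover. Qed.

(* The kernel lies between alpha and beta, and f keeps it from being beta. *)
Lemma covered_polynomial_kernel f x y :
  unary_polynomial w f -> beta x y -> ~~ alpha (f x) (f y) ->
  polynomial_kernel w alpha beta f =2 alpha.
Proof.
move=> pf xy nfxy; case: alpha_cover => _ _ sub_ab _ maximal.
have ker_cong := polynomial_kernel_congruence f alpha_cong beta_cong.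
have [a b ab||//|ker_beta] := maximal _ ker_cong.
- apply/andP; split; first exact: sub_ab.
  apply/asboolP => g pg.
  exact: congruence_unary alpha_cong pf (congruence_unary alpha_cong pg ab).
- by move=> a b /andP[].
have : polynomial_kernel w alpha beta f x y by rewrite ker_beta.
case/andP=> _ /asboolP/(_ id (unary_polynomial_id w)) fxy.
by rewrite fxy in nfxy.
Qed.

Lemma separating_translation f x y a b :
  unary_polynomial w f -> beta x y -> ~~ alpha (f x) (f y) ->
  beta a b -> ~~ alpha a b ->
  exists2 g, unary_polynomial w g & ~~ alpha (f (g a)) (f (g b)).
Proof.
move=> pf xy nfxy ab; rewrite -(covered_polynomial_kernel pf xy nfxy).
rewrite /polynomial_kernel ab => /asboolPn/existsNP[g /not_implyP[pg nfgab]].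
by exists g => //; apply/negP.
Qed.

Lemma separating_imageP U : separating_image w alpha beta U <->
  exists2 f, unary_polynomial w f &
    (exists x y, beta x y /\ ~~ alpha (f x) (f y)) /\ U = f @: [set: A].
Proof.
split=> [[f [pf sep_f ->]]|[f pf [sep_f ->]]].
  by exists (fun x => f [tuple x]); first exact: unary_polynomial_tuple.
by exists (fun x => f (tnth x ord0)).
Qed.

(* A polynomial mapping U onto itself permutes it; some iterate is inverse. *)
Lemma minimal_set_permutation_inverse U s : minimal_set w alpha beta U ->
  unary_polynomial w s -> {homo s : x / x \in U} ->
  separating_image w alpha beta (s @: U) ->
  exists2 r, unary_polynomial w r &
    {homo r : x / x \in U} /\ {in U, cancel s r}.
Proof.
move=> [_ minU] ps sU sep_sU.
have sUU : s @: U = U.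
  by apply: minU => //; apply/subsetP => _ /imsetP[x xU ->]; apply: sU.
have s_inj : {in U &, injective s} by apply/imset_injP; rewrite sUU.
have [k sK] := iter_cancel_in sU s_inj.
exists (iter k s); first exact: unary_polynomial_iter.
by split=> // x xU; elim: k {sK} => [//|k IHk] /=; apply: sU.
Qed.

Lemma minimal_set_retraction U : minimal_set w alpha beta U ->
  exists2 e, unary_polynomial w e & (forall x, e x \in U) /\ {in U, e =1 id}.
Proof.
move=> minU.
have [/separating_imageP[f pf [[x [y [xy nfxy]]] U_def]] _] := minU.
have fU z : f z \in U by rewrite U_def imset_f.
have fxy : beta (f x) (f y) := congruence_unary beta_cong pf xy.
have [g pg ngf] := separating_translation pf xy nfxy fxy nfxy.
have ps : unary_polynomial w (f \o g) := polynomial_comp1 pf pg.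
have sU : {homo (f \o g) : z / z \in U} by move=> z _; apply: fU.
have [|r pr [rU rK]] := minimal_set_permutation_inverse minU ps sU.
  apply/separating_imageP.
  exists (f \o g \o f); first exact: polynomial_comp1 ps pf.
  by split; [exists x, y | rewrite U_def -imset_comp].
exists (r \o (f \o g)); first exact: polynomial_comp1 pr ps.
by split=> [z|z zU]; [apply/rU/fU | apply: rK].
Qed.

Lemma minimal_set_left_inverse U p u v :
  minimal_set w alpha beta U -> unary_polynomial w p ->
  u \in U -> v \in U -> beta u v -> ~~ alpha (p u) (p v) ->
  exists2 q, unary_polynomial w q &
    (forall x, q x \in U) /\ {in U, cancel p q}.
Proof.
move=> minU pp uU vU uv npuv.
have [e pe [eU eK]] := minimal_set_retraction minU.
have neuv : ~~ alpha (e u) (e v).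
  by rewrite !eK //; apply: contra npuv; apply: congruence_unary alpha_cong pp.
have [g pg negp] :=
  separating_translation pe uv neuv (congruence_unary beta_cong pp uv) npuv.
have peg : unary_polynomial w (e \o g) := polynomial_comp1 pe pg.
have ps : unary_polynomial w (e \o g \o p) := polynomial_comp1 peg pp.
have sU : {homo (e \o g \o p) : z / z \in U} by move=> z _; apply: eU.
have [|r pr [rU rK]] := minimal_set_permutation_inverse minU ps sU.
  apply/separating_imageP.
  exists (e \o g \o p \o e); first exact: polynomial_comp1 ps pe.
  split; first by exists u, v; split; rewrite //= (eK u) ?(eK v).
  apply/setP => z; apply/imsetP/imsetP => -[x xU ->].
    by exists x; rewrite ?inE //= (eK x).
  by exists (e x).
exists (r \o (e \o g)); first exact: polynomial_comp1 pr peg.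
by split=> [z|z zU]; [apply/rU/eU | apply: rK].
Qed.

End MinimalSets.

Section MeetOrder.
Variables (A : finType) (n : nat) (w : operation A n) (sim : rel A).
Hypothesis sim_cong : congruence w sim.
Implicit Types (p q : A -> A) (h : A -> A -> A) (P : pred A).

Let sim_equiv : equivalence_rel sim. Proof. by case: sim_cong. Qed.
Let sim_refl := equivalence_refl sim_equiv.
Let sim_sym := equivalence_sym sim_equiv.
Let sim_trans := equivalence_trans sim_equiv.
Let sim_eql := equivalence_left_transitive sim_equiv.
Let sim_unary := fun p a b => @congruence_unary _ _ w sim p a b sim_cong.
Let sim_binary := fun h a b c d =>
  @congruence_binary _ _ w sim h a b c d sim_cong.

Definition has_meet a b : Prop :=
  exists2 h, binary_polynomial w h &
    [/\ sim (h a a) a, sim (h a b) a, sim (h b a) a & sim (h b b) b].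

Definition two_valued a b p : Prop := forall x, sim (p x) a || sim (p x) b.

(* What remains of a minimal set meeting exactly the classes of a and b when it
   is only looked at modulo sim. *)
Definition minimal_pair a b : Prop :=
  ~~ sim a b /\
  forall p, unary_polynomial w p -> ~~ sim (p a) (p b) ->
  exists2 q, unary_polynomial w q &
    [/\ two_valued a b q, sim (q (p a)) a & sim (q (p b)) b].

Definition meet_edge a b : Prop :=
  [/\ minimal_pair a b, has_meet a b & ~ has_meet b a].

Lemma has_meet_transfer p q a b a' b' :
  unary_polynomial w p -> unary_polynomial w q ->
  sim (p a) a' -> sim (p b) b' -> sim (q a') a -> sim (q b') b ->
  has_meet a b -> has_meet a' b'.
Proof.
move=> pp pq pa pb qa qb [h ph [haa hab hba hbb]].
have transfer x y z x' y' z' :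
    sim (q x') x -> sim (q y') y -> sim (h x y) z -> sim (p z) z' ->
    sim (p (h (q x') (q y'))) z'.
  move=> qx qy hxy; apply: sim_trans; apply: sim_unary => //.
  exact: sim_trans (sim_binary ph qx qy) hxy.
exists (fun x y => p (h (q x) (q y))).
  exact: polynomial_comp1 pp (binary_polynomial_comp ph pq pq).
by split; [exact: transfer haa pa | exact: transfer hab pa
          | exact: transfer hba pa | exact: transfer hbb pb].
Qed.

Lemma minimal_pair_image p a b :
  unary_polynomial w p -> minimal_pair a b -> ~~ sim (p a) (p b) ->
  minimal_pair (p a) (p b).
Proof.
move=> pp [_ inv_ab] npab; split=> // r pr nrpab.
have [q pq [q_ab qa qb]] := inv_ab (r \o p) (polynomial_comp1 pr pp) nrpab.
exists (p \o q); first exact: polynomial_comp1 pp pq.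
split=> [x||]; [|exact: sim_unary pp qa|exact: sim_unary pp qb].
by case/orP: (q_ab x) => /(sim_unary pp) qx; apply/orP; [left | right].
Qed.

Lemma meet_edge_image p a b :
  unary_polynomial w p -> meet_edge a b -> ~~ sim (p a) (p b) ->
  meet_edge (p a) (p b).
Proof.
move=> pp [ab_min ab_meet ba_nomeet] npab; have [_ inv_ab] := ab_min.
have [q pq [_ qa qb]] := inv_ab p pp npab; split.
- exact: minimal_pair_image.
- by apply: (has_meet_transfer pp pq) ab_meet.
- move=> pba_meet; apply: ba_nomeet.
  by apply: (has_meet_transfer pq pp) pba_meet.
Qed.

Definition meet_le : A -> A -> Prop :=
  clos_refl_trans A (fun a b => sim a b \/ meet_edge a b).

Lemma meet_le_sim a b : sim a b -> meet_le a b.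
Proof. by move=> ab; apply: rt_step; left. Qed.

Lemma meet_ge_sim a b : sim a b -> meet_le b a.
Proof. by rewrite sim_sym; apply: meet_le_sim. Qed.

Lemma meet_le_edge a b : meet_edge a b -> meet_le a b.
Proof. by move=> ab; apply: rt_step; right. Qed.

Lemma meet_le_refl a : meet_le a a.
Proof. exact: rt_refl. Qed.
#[local] Hint Resolve meet_le_refl : core.

Lemma meet_le_trans b a c : meet_le a b -> meet_le b c -> meet_le a c.
Proof. exact: rt_trans. Qed.

Lemma meet_le_unary p a b :
  unary_polynomial w p -> meet_le a b -> meet_le (p a) (p b).
Proof.
move=> pp; elim=> {a b} [a b [ab|ab]|a|a b c _ ab _ bc].
- exact/meet_le_sim/sim_unary.
- have [pab|npab] := boolP (sim (p a) (p b)); first exact: meet_le_sim.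
  exact/meet_le_edge/meet_edge_image.
- exact: meet_le_refl.
- exact: meet_le_trans ab bc.
Qed.

Lemma meet_le_polynomial m (f : operation A m) (x y : m.-tuple A) :
  polynomial w f -> (forall i, meet_le (tnth x i) (tnth y i)) ->
  meet_le (f x) (f y).
Proof.
move=> pf; apply: (polynomial_compat_unary meet_le_refl _ _ pf).
  by move=> a b c; apply: meet_le_trans.
by move=> p pp a b; apply: meet_le_unary.
Qed.

(* The second clause, in place of closure under meets, says that no binary
   polynomial is a join when only membership in P is observed. *)
Definition polynomial_filter P : Prop :=
  (forall x y, meet_le x y -> P x -> P y) /\
  (forall h a b a' b', binary_polynomial w h -> meet_le a b -> meet_le a' b' ->
    P (h b a') -> P (h a b') -> P (h a a')).

Section TwoValuedPolynomials.
Variables s t : A.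
Hypothesis st_edge : meet_edge s t.

Lemma two_valued_le p x y :
  unary_polynomial w p -> two_valued s t p ->
  meet_le x y -> sim (p x) t -> sim (p y) t.
Proof.
move=> pp p_st; elim=> {x y} [x y [xy|xy]|//|x y z _ xy _ yz /xy/yz //] pxt.
  by rewrite -(sim_eql (sim_unary pp xy)).
case/orP: (p_st y) => // pys; have [[nst _] _ ts_nomeet] := st_edge.
have npxy : ~~ sim (p x) (p y) by rewrite (sim_eql pxt) sim_sym (sim_eql pys).
have [_ pxy_meet _] := meet_edge_image pp xy npxy.
case: ts_nomeet; have pid := unary_polynomial_id w.
by apply: (has_meet_transfer pid pid _ _ _ _ pxy_meet) => //; rewrite sim_sym.
Qed.

Section BinaryPolynomial.
Variable j : A -> A -> A.
Hypotheses (pj : binary_polynomial w j) (j_st : forall x, two_valued s t (j x)).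

Let j_le_l x x' y : meet_le x x' -> sim (j x y) t -> sim (j x' y) t.
Proof.
by apply: (two_valued_le (binary_polynomial_fixr y pj)) => z; apply: j_st.
Qed.

Let j_le_r x y y' : meet_le y y' -> sim (j x y) t -> sim (j x y') t.
Proof. exact: two_valued_le (binary_polynomial_fixl x pj) (j_st x). Qed.

(* Otherwise j would act as a join on the four points, and composing it with
   polynomials that carry (s, t) to (x, x') and to (y, y') would give a join on
   the pair (s, t). *)
Lemma two_valued_edge_meet x x' y y' :
  meet_edge x x' -> meet_edge y y' ->
  sim (j x' y) t -> sim (j x y') t -> sim (j x y) t.
Proof.
move=> xx' yy' jx'y jxy'; case/orP: (j_st x y) => // jxy.
have [[nst _] _ ts_nomeet] := st_edge.
have nsim z : sim z t -> ~~ sim (j x y) z.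
  by move=> zt; rewrite (sim_eql jxy) sim_sym (sim_eql zt) sim_sym.
have [[_ inv_x] _ _] := xx'; have [[_ inv_y] _ _] := yy'.
have [q pq [_ qx qx']] := inv_x _ (binary_polynomial_fixr y pj) (nsim _ jx'y).
have [r pr [_ ry ry']] := inv_y _ (binary_polynomial_fixl x pj) (nsim _ jxy').
have qs : sim (q s) x by rewrite -(sim_eql (sim_unary pq jxy)).
have qt : sim (q t) x' by rewrite -(sim_eql (sim_unary pq jx'y)).
have rs : sim (r s) y by rewrite -(sim_eql (sim_unary pr jxy)).
have rt : sim (r t) y' by rewrite -(sim_eql (sim_unary pr jxy')).
case: ts_nomeet; exists (fun c d => j (q c) (r d)).
  exact: binary_polynomial_comp.
split.
- rewrite (sim_eql (sim_binary pj qt rt)).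
  exact: j_le_r (meet_le_edge yy') jx'y.
- by rewrite (sim_eql (sim_binary pj qt rs)).
- by rewrite (sim_eql (sim_binary pj qs rt)).
- by rewrite (sim_eql (sim_binary pj qs rs)).
Qed.

Lemma two_valued_meet a b a' b' :
  meet_le a b -> meet_le a' b' ->
  sim (j b a') t -> sim (j a b') t -> sim (j a a') t.
Proof.
have j_sim_l x x' y : sim x x' -> sim (j x' y) t -> sim (j x y) t.
  by move/meet_ge_sim; apply: j_le_l.
have j_sim_r x y y' : sim y y' -> sim (j x y') t -> sim (j x y) t.
  by move/meet_ge_sim; apply: j_le_r.
have edge_meet x x' : meet_edge x x' -> meet_le a' b' ->
    sim (j x' a') t -> sim (j x b') t -> sim (j x a') t.
  move=> xx'.
  elim/clos_refl_trans_ind_right: a' / => // y y' yy' IH _ jx'y jxb'.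
  have jxy' : sim (j x y') t.
    by apply: IH => //; apply: j_le_r jx'y; apply: rt_step.
  case: yy' => yy'; first exact: j_sim_r yy' jxy'.
  exact: two_valued_edge_meet xx' yy' jx'y jxy'.
move=> ab ab'.
elim/clos_refl_trans_ind_right: a / ab => // x x' xx' IH _ jba' jxb'.
have jx'a' : sim (j x' a') t.
  by apply: IH => //; apply: j_le_l jxb'; apply: rt_step.
case: xx' => xx'; first exact: j_sim_l xx' jx'a'.
exact: edge_meet xx' ab' jx'a' jxb'.
Qed.

End BinaryPolynomial.

Lemma two_valued_filter p :
  unary_polynomial w p -> two_valued s t p ->
  polynomial_filter (fun x => sim (p x) t).
Proof.
move=> pp p_st; split=> [x y|h a b a' b' ph]; first exact: two_valued_le.
apply: (@two_valued_meet (fun x y => p (h x y))) => [|x y]; last exact: p_st.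
exact: polynomial_comp1.
Qed.

End TwoValuedPolynomials.

Lemma meet_lt_filter a b : meet_le a b -> ~~ sim a b ->
  exists2 P, polynomial_filter P & ~~ P a /\ P b.
Proof.
elim/clos_refl_trans_ind_right: a /; first by rewrite sim_refl.
move=> a c [ac|ac] IH cb nab.
  have [|P Pfilter [nPc Pb]] := IH; first by rewrite -(sim_eql ac).
  exists P => //; split=> //; apply: contra nPc.
  by have [P_le _] := Pfilter; apply: P_le; apply: meet_le_sim.
have [[nac inv_ac] _ _] := ac.
have [q pq [q_ac qa qc]] := inv_ac id (unary_polynomial_id w) nac.
exists (fun x => sim (q x) c); first exact: (two_valued_filter ac pq q_ac).
by split; [rewrite /= (sim_eql qa) | apply: (two_valued_le ac pq q_ac cb)].
Qed.

Lemma meet_le_antisym a b : meet_le a b -> meet_le b a -> sim a b.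
Proof.
move=> ab ba; apply: contraT => nab.
have [P [P_le _] [/negP nPa Pb]] := meet_lt_filter ab nab.
by case: nPa; apply: P_le Pb.
Qed.

Lemma descending_seq_bottom (c : nat -> A) a :
  (forall k, meet_le (c k.+1) (c k)) -> (forall k, meet_le a (c k)) ->
  (forall k, sim (c k.+1) (c k) -> sim a (c k)) -> sim a (c #|A|).
Proof.
move=> c_desc a_le c_stable.
have c_le i j : i <= j -> meet_le (c j) (c i).
  move=> /subnKC<-; elim: (j - i) => [|k IHk]; first by rewrite addn0.
  by rewrite addnS; apply: meet_le_trans IHk.
have [i [j [lt_ij le_j cij]]] := finite_seq_repeat c.
apply: meet_le_antisym => //; apply: meet_le_trans (c_le i _ _) _.
  exact: leq_trans (ltnW lt_ij) le_j.
apply/meet_ge_sim/c_stable/meet_le_antisym => //.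
by rewrite cij; apply: c_le.
Qed.

Lemma polynomial_filter_setU P m (f : operation A m) S T a b :
  polynomial_filter P -> polynomial w f -> meet_le a b ->
  P (f (block_tuple S a b)) -> P (f (block_tuple T a b)) ->
  P (f (block_tuple (S :|: T) a b)).
Proof.
move=> [_ P_meet] pf ab PS PT.
pose h x y := f [tuple if k \in S then if k \in T then a else x
                       else if k \in T then y else b | k < m].
have ph : binary_polynomial w h.
  apply: (polynomial_comp (g := fun k (z : 2.-tuple A) =>
    if k \in S then if k \in T then a else tnth z ord0
    else if k \in T then tnth z ord_max else b)) => // k.
  by case: (k \in S) (k \in T) => -[];
    [apply: polynomial_const | apply: polynomial_var
    |apply: polynomial_var | apply: polynomial_const].
have block (R : {set 'I_m}) x y :
    (forall k, (if k \in S then if k \in T then a else x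
                else if k \in T then y else b) = if k \in R then a else b) ->
    h x y = f (block_tuple R a b).
  by move=> eqR; congr f; apply: eq_from_tnth => k; rewrite !tnth_mktuple eqR.
rewrite -(block (S :|: T) a a); last by move=> k; rewrite inE; do 2 case: ifP.
apply: (P_meet _ _ _ _ _ ph ab ab).
  by rewrite (block T) // => k; do 2 case: ifP.
by rewrite (block S) // => k; do 2 case: ifP.
Qed.

Section IdempotentPolynomial.
Variables (m : nat) (f : operation A m).
Hypotheses (pf : polynomial w f) (f_id : Defs.idempotent_op f).

Lemma idempotent_ge (x : m.-tuple A) a :
  (forall k, meet_le a (tnth x k)) -> meet_le a (f x).
Proof.
move=> ax; rewrite -[a]f_id; apply: meet_le_polynomial => // k.
by rewrite tnth_mktuple.
Qed.

Lemma idempotent_le (x : m.-tuple A) b :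
  (forall k, meet_le (tnth x k) b) -> meet_le (f x) b.
Proof.
move=> xb; rewrite -[b]f_id; apply: meet_le_polynomial => // k.
by rewrite tnth_mktuple.
Qed.

Lemma circ_ge a x y : meet_le a x -> meet_le a y -> meet_le a (circ f x y).
Proof.
by move=> ax ay; apply: idempotent_ge => k; rewrite tnth_mktuple; case: ifP.
Qed.

Lemma circ_le b x y : meet_le x b -> meet_le y b -> meet_le (circ f x y) b.
Proof.
by move=> xb yb; apply: idempotent_le => k; rewrite tnth_mktuple; case: ifP.
Qed.

End IdempotentPolynomial.

Section WeakNearUnanimity.
Variables (m : nat) (f : operation A m).
Hypotheses (pf : polynomial w f) (f_wnu : weak_near_unanimity f).

Let f_id : Defs.idempotent_op f. Proof. by case: f_wnu. Qed.

Lemma sim_circ x x' y y' :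
  sim x x' -> sim y y' -> sim (circ f x y) (circ f x' y').
Proof.
move=> xx' yy'; apply: congruence_polynomial sim_cong pf _ => k.
by rewrite !tnth_mktuple; case: ifP.
Qed.

Lemma wnu_meet a b (x : m.-tuple A) :
  meet_le a b -> sim a (circ f b a) ->
  (forall k, sim a (tnth x k) || sim b (tnth x k)) ->
  sim (if [exists k, sim a (tnth x k)] then a else b) (f x).
Proof.
move=> ab fba x_ab.
have a_le k : meet_le a (tnth x k).
  case/orP: (x_ab k) => [/meet_le_sim //|/meet_le_sim]; exact: meet_le_trans.
have le_b k : meet_le (tnth x k) b.
  case/orP: (x_ab k) => /meet_ge_sim // xa; exact: meet_le_trans ab.
case: existsP => [[i ai]|no_a]; last first.
  rewrite -[b]f_id; apply: congruence_polynomial sim_cong pf _ => k.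
  rewrite tnth_mktuple.
  by case/orP: (x_ab k) => // ak; case: no_a; exists k.
apply: meet_le_antisym; first exact: (idempotent_ge pf f_id).
have m_gt0 : 0 < m := leq_ltn_trans (leq0n i) (ltn_ord i).
apply: (@meet_le_trans (circ f b a)); last exact: meet_ge_sim.
have [_ f_sym] := f_wnu; rewrite /circ (f_sym (Ordinal m_gt0) i).
apply: meet_le_polynomial => // k.
by rewrite tnth_mktuple; case: eqP => [/val_inj-> |_ //]; apply: meet_ge_sim.
Qed.

Hypothesis m_gt1 : 1 < m.
Let i0 : 'I_m := Ordinal (ltnW m_gt1).
Let i1 : 'I_m := Ordinal m_gt1.

(* f(b, a, ..., a) = f(a, b, a, ..., a), so a filter containing this value also
   contains f(a, ..., a) = a. *)
Lemma circ_lower_sim a b : meet_le a b -> sim (circ f a b) a.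
Proof.
move=> ab; rewrite sim_sym; apply: contraT => nac.
have ac : meet_le a (circ f a b) by apply: circ_ge.
have [P Pfilter [/negP nPa Pc]] := meet_lt_filter ac nac; case: nPa.
have setT_eq : [set~ i0] :|: [set~ i1] = setT.
  by rewrite -setCI; apply/setP => k; rewrite !inE; case: eqP => // ->.
rewrite -[a]f_id -(block_tuple_setT m a b) -setT_eq.
apply: (polynomial_filter_setU Pfilter pf ab); rewrite -one_at_blockC //.
by have [_ f_sym] := f_wnu; rewrite (f_sym i1 i0).
Qed.

(* A filter containing b and all the values f(b, ..., a, ..., b) also contains
   f(a, ..., a) = a. *)
Lemma circ_upper_sim_inv a b : meet_le a b -> sim (circ f b a) b -> sim a b.
Proof.
move=> ab cb; apply: contraT => nab.
have [P Pfilter [/negP nPa Pb]] := meet_lt_filter ab nab; case: nPa.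
have Pc : P (circ f b a).
  by have [P_le _] := Pfilter; apply: P_le Pb; apply: meet_ge_sim.
have setT_eq : \bigcup_(k : 'I_m) [set k] = setT.
  by apply/setP => k; rewrite inE; apply/bigcupP; exists k; rewrite ?set11.
rewrite -[a]f_id -(block_tuple_setT m a b) -setT_eq.
elim/big_ind: _ => [|S T|k _]; first by rewrite block_tuple_set0 f_id.
  exact: (polynomial_filter_setU Pfilter pf ab).
by have [_ f_sym] := f_wnu; rewrite -one_at_block (f_sym k i0).
Qed.

Lemma circ_wnu_step_descent a b : meet_le a b ->
  let c := circ f b a in let d := circ (wnu_step f) b a in
  meet_le d c /\ (sim d c -> sim a c).
Proof.
move=> ab c d.
have ac : meet_le a c by apply: circ_ge.
have cb : meet_le c b by apply: circ_le.
have cac : meet_le (circ f c a) c by apply: circ_le.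
have dE : sim d (circ f c (circ f c a)).
  by rewrite /d circ_wnu_step; apply: sim_circ; [apply: circ_lower_sim|].
split; first by apply: meet_le_trans (meet_le_sim dE) (circ_le pf f_id _ cac).
by rewrite (sim_eql dE) => /(circ_upper_sim_inv cac); apply: circ_upper_sim_inv.
Qed.

End WeakNearUnanimity.

Lemma circ_wnu_seq_card a b : weak_near_unanimity w -> meet_le a b ->
  sim a (circ (wnu_seq w #|A|) b a).
Proof.
move=> w_wnu ab; have [le_n1|n_gt1] := leqP n 1.
  by rewrite circ_arity_le1 //; have [] := wnu_seq_wnu #|A| w_wnu.
pose c k := if k is _.+1 then circ (wnu_seq w k) b a else b.
have card_gt0 : 0 < #|A| by apply/card_gt0P; exists a.
have -> : circ (wnu_seq w #|A|) b a = c #|A| by case: #|A| card_gt0.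
have seq_poly k := polynomial_wnu_seq w k.
have seq_wnu k := wnu_seq_wnu k w_wnu; have seq_id k := (seq_wnu k).1.
have c_step k : meet_le (c k.+1) (c k) /\ (sim (c k.+1) (c k) -> sim a (c k)).
  case: k => [|k]; last first.
    exact: circ_wnu_step_descent (seq_poly k.+1) (seq_wnu k.+1) _ _ _ _.
  by split; [apply: circ_le | apply: circ_upper_sim_inv].
apply: descending_seq_bottom => k; [exact: (c_step k).1| |exact: (c_step k).2].
by case: k => [//|k]; apply: circ_ge.
Qed.

End MeetOrder.

Lemma bool_polynomial_meet m (g : operation bool m) (x y : m.-tuple bool) :
  polynomial bool_meet g ->
  g [tuple tnth x i && tnth y i | i < m] = g x && g y.
Proof.
case=> t gt; rewrite !gt.
elim: t {g gt} => [i|a|args IH] /=; first by rewrite tnth_mktuple.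
  by rewrite andbb.
by rewrite /bool_meet !tnth_mktuple !IH andbACA.
Qed.

Section SemilatticeCharts.
Variables (A : finType) (n : nat) (w : operation A n) (sim : rel A).
Hypothesis sim_cong : congruence w sim.
Variables (N : {set A}) (phi : A -> bool).
Hypothesis phi_chart : semilattice_chart w sim N phi.
Variables u v : A.
Hypotheses (uN : u \in N) (vN : v \in N).
Hypotheses (phi_u : phi u = false) (phi_v : phi v).

Lemma semilattice_chart_has_meet : has_meet w sim u v.
Proof.
have [phiE _ /(_ 2 bool_meet)[lift_poly _]] := phi_chart.
have [f [pf fN phi_f]] := lift_poly (polynomial_basic _).
have fE x y : x \in N -> y \in N ->
    f [tuple x; y] \in N /\ phi (f [tuple x; y]) = phi x && phi y.
  move=> xN yN; have xyN i : tnth [tuple x; y] i \in N.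
    by case: i => [[|[|//]] lt_i].
  by split; [apply: fN | rewrite phi_f // /bool_meet !tnth_map].
exists (fun x y => f [tuple x; y]); first exact: binary_polynomial_tuple.
have [[fuu phi_uu] [fuv phi_uv]] := (fE u u uN uN, fE u v uN vN).
have [[fvu phi_vu] [fvv phi_vv]] := (fE v u vN uN, fE v v vN vN).
by rewrite !phiE // phi_uu phi_uv phi_vu phi_vv phi_u phi_v.
Qed.

(* A join polynomial, retracted onto N, would be a polynomial operation of the
   two-element meet semilattice; but those preserve meets. *)
Lemma semilattice_chart_no_join e :
  unary_polynomial w e -> (forall x, e x \in N) -> {in N, e =1 id} ->
  ~ has_meet w sim v u.
Proof.
move=> pe eN eK [h ph [hvv hvu huv huu]].
have [phiE _ chart] := phi_chart.
have [sim_equiv _] := sim_cong; have sim_refl := equivalence_refl sim_equiv.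
pose f (x : 2.-tuple A) := e (h (tnth x ord0) (tnth x ord_max)).
have pf : polynomial w f := polynomial_comp1 pe ph.
have phi_f x y z : z \in N -> sim (h x y) z -> phi (f [tuple x; y]) = phi z.
  move=> zN hxy; apply/eqP; rewrite -phiE ?eN // -[z]eK //.
  exact: congruence_unary sim_cong pe hxy.
pose r (c : bool) := if c then v else u.
have rN c : r c \in N by case: c.
have phi_r c : phi (r c) = c by case: c.
pose g (x : 2.-tuple bool) := phi (f (map_tuple r x)).
have pg : polynomial bool_meet g.
  apply/chart; exists f; split=> // [x _|x xN]; first exact: eN.
  apply/eqP; rewrite -phiE ?eN //.
  apply: congruence_polynomial sim_cong pf _ => i.
  by rewrite !tnth_map phiE ?phi_r.
have gE c d : g [tuple c; d] = phi (f [tuple r c; r d]).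
  by congr (phi (f _)); apply: eq_from_tnth => -[[|[|//]] lt_i].
have := bool_polynomial_meet [tuple false; true] [tuple true; false] pg.
rewrite (_ : [tuple _ | _ < _] = [tuple false; false]); last first.
  by apply: eq_from_tnth => -[[|[|//]] lt_i]; rewrite tnth_mktuple.
by rewrite !gE (phi_f u u u) // (phi_f u v v) // (phi_f v u v) // phi_u phi_v.
Qed.

End SemilatticeCharts.

Section Classes.
Variables (A : finType) (e : rel A).
Hypothesis e_equiv : equivalence_rel e.

Definition eqv_class (x : A) : {set A} := [set y | e x y].

Lemma mem_eqv_class x : x \in eqv_class x.
Proof. by rewrite inE equivalence_refl. Qed.

Lemma classesP C : reflect (exists x, C = eqv_class x) (C \in classes e).
Proof.
have classE x : eqv_class x = [set y in [set: A] | e x y].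
  by apply/setP => y; rewrite !inE.
apply: (iffP imsetP) => [[x _ ->]|[x ->]].
  by exists x; rewrite classE.
by exists x; rewrite ?inE // classE.
Qed.

Lemma classes_tuple m (X : m.-tuple {set A}) :
  (forall k, tnth X k \in classes e) ->
  exists x : m.-tuple A, X = map_tuple eqv_class x.
Proof.
move=> X_class; have /fin_all_exists[x xE] k := classesP _ (X_class k).
exists [tuple x k | k < m]; apply: eq_from_tnth => k.
by rewrite tnth_map tnth_mktuple.
Qed.

Lemma eqv_class_eq x y : (eqv_class x == eqv_class y) = e x y.
Proof.
apply/eqP/idP => [eq_xy|xy].
  by have := mem_eqv_class y; rewrite -eq_xy inE.
by apply/setP => z; rewrite !inE (equivalence_left_transitive e_equiv xy).
Qed.

Lemma quotient_op_eqv_class m (f : operation A m) (x : m.-tuple A) :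
  (forall y z : m.-tuple A,
    (forall i, e (tnth y i) (tnth z i)) -> e (f y) (f z)) ->
  quotient_op e f (map_tuple eqv_class x) = eqv_class (f x).
Proof.
move=> f_compat; apply/setP => y; rewrite !inE.
apply/existsP/idP => [[z /andP[/forallP xz fzy]]|fxy].
  apply: equivalence_trans fzy => //; apply: f_compat => i.
  by have := xz i; rewrite tnth_map inE.
exists x; rewrite fxy andbT; apply/forallP => i.
by rewrite tnth_map mem_eqv_class.
Qed.

End Classes.

Section ClassOrder.
Variables (A : finType) (n : nat) (w : operation A n) (sim : rel A).
Hypothesis sim_cover : covered_by w sim full_rel.

Let sim_cong : congruence w sim. Proof. by case: sim_cover. Qed.
Let sim_equiv : equivalence_rel sim. Proof. by case: sim_cong. Qed.

Lemma minimal_set_meet_edge U phi u v :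
  minimal_set w sim full_rel U -> semilattice_chart w sim U phi ->
  u \in U -> v \in U -> phi u = false -> phi v -> meet_edge w sim u v.
Proof.
move=> minU phi_chart uU vU phi_u phi_v; have [phiE _ _] := phi_chart.
have [e pe [eU eK]] := minimal_set_retraction sim_cover minU.
split; [split=> [|p pp npuv]| |].
- by rewrite phiE // phi_u phi_v.
- have [q pq [qU qK]] :=
    minimal_set_left_inverse sim_cover minU pp uU vU isT npuv.
  exists q => //; rewrite !qK // !(equivalence_refl sim_equiv); split=> // x.
  by rewrite !phiE ?qU // phi_u phi_v; case: (phi _).
- exact: (semilattice_chart_has_meet phi_chart uU vU phi_u phi_v).
- exact: (semilattice_chart_no_join sim_cong phi_chart uU vU phi_u phi_v pe).
Qed.

Lemma basic_below_meet_edge C D : basic_below w sim C D ->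
  exists u v, [/\ u \in C, v \in D & meet_edge w sim u v].
Proof.
case=> _ _ [U [phi [minU phi_chart CU DU]]]; have [_ phi_onto _] := phi_chart.
have preimage c : exists2 x, x \in U & phi x = c.
  have /imsetP[x xU ->] : c \in phi @: U by rewrite phi_onto inE.
  by exists x.
have [u uU phi_u] := preimage false; have [v vU phi_v] := preimage true.
exists u, v; split; last exact: minimal_set_meet_edge minU phi_chart _ _ _ _.
  have : u \in C :&: U by rewrite CU inE uU phi_u.
  by case/setIP.
have : v \in D :&: U by rewrite DU inE vU phi_v.
by case/setIP.
Qed.

Lemma class_le_meet_le C D a b :
  D \in classes sim -> class_le w sim C D -> a \in C -> b \in D ->
  meet_le w sim a b.
Proof.
have class_meet_le E x y :
    E \in classes sim -> x \in E -> y \in E -> meet_le w sim x y.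
  case/classesP => z ->; rewrite !inE => zx zy; apply: meet_le_sim.
  by rewrite -(equivalence_left_transitive sim_equiv zx).
move=> D_class CD aC bD.
elim/clos_refl_trans_ind_right: C / CD a aC => [a aD|C E CE IH _ a aC].
  exact: class_meet_le aD bD.
have [C_class _ _] := CE; have [u [v [uC vE uv]]] := basic_below_meet_edge CE.
apply: meet_le_trans (class_meet_le _ _ _ C_class aC uC) _.
exact: meet_le_trans (meet_le_edge uv) (IH v vE).
Qed.

End ClassOrder.

Lemma big_chain_meet (A : finType) (O I : {set A}) n (X : n.-tuple {set A}) :
  \big[chain_meet O I/I]_(i < n) tnth X i
    = if [exists i, tnth X i == O] then O else I.
Proof.
have -> : [exists i, tnth X i == O] = \big[orb/false]_(i < n) (tnth X i == O).
  by rewrite big_orE; apply: eq_existsb.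
elim/big_rec2: _ => // i b Y _ ->.
rewrite /chain_meet; case: eqP => //= _.
by case: b; rewrite ?eqxx //; case: eqP.
Qed.

Theorem theorem3p3 (A : finType) (n : nat) (w : operation A n) (sim : rel A)
    (w_wnu : weak_near_unanimity w)
    (sim_abelian : abelian_congruence w sim)
    (sim_cover : covered_by w sim full_rel)
    (sim_type5 : has_type5 w sim full_rel)
    (O I : {set A}) (O_class : O \in classes sim) (I_class : I \in classes sim)
    (ltOI : class_lt w sim O I) :
  subuniverse (wnu_seq w #|A|) (O :|: I) /\
  forall X : n.-tuple {set A},
    (forall i, tnth X i \in [set O; I]) ->
    quotient_op sim (wnu_seq w #|A|) X
      = \big[chain_meet O I/I]_(i < n) tnth X i.
Proof.
have sim_cong : congruence w sim by case: sim_cover.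
have [[sim_equiv _] [leOI _]] := (sim_cong, ltOI).
have [[o OE] [i IE]] := (classesP _ _ O_class, classesP _ _ I_class); subst O I.
have oi : meet_le w sim o i.
  by apply: class_le_meet_le leOI _ _; rewrite ?mem_eqv_class.
have [pf f_wnu] := (polynomial_wnu_seq w #|A|, wnu_seq_wnu #|A| w_wnu).
have f_oi := circ_wnu_seq_card sim_cong w_wnu oi.
have f_meet := wnu_meet sim_cong pf f_wnu oi f_oi.
split=> [x xOI|X XOI].
  have /f_meet : forall k, sim o (tnth x k) || sim i (tnth x k).
    by move=> k; have := xOI k; rewrite !inE.
  by rewrite !inE; case: ifP => _ ->; rewrite ?orbT.
have [x XE] : exists x : n.-tuple A, X = map_tuple (eqv_class sim) x.
  by apply: classes_tuple => k; case/set2P: (XOI k) => ->.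
have classE a k : (tnth X k == eqv_class sim a) = sim a (tnth x k).
  by rewrite XE tnth_map eqv_class_eq // equivalence_sym.
rewrite big_chain_meet (eq_existsb (classE o)) -fun_if.
rewrite XE quotient_op_eqv_class //.
  apply/esym/eqP; rewrite eqv_class_eq //; apply: f_meet => k.
  by rewrite -!classE -in_set2.
by move=> y z; apply: congruence_polynomial sim_cong pf.
Qed.
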